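(* Let $0<q<1$, let $\alpha\ge0$ and $k,N\ge1$ be integers. Then \[ M_\alpha(k,N)=\frac{q^{k(2-2N-\alpha)}}{N\,(1-q^2)^k}\, \frac{(q^{2N};q^2)_k\,(q^{2N+2\alpha};q^2)_k}{(q^2;q^2)_k}\; {}_3\phi_2\!\left(\begin{matrix}q^{2-2k},\,q^{2-2N},\,q^{2-2N-2\alpha}\\ q^{2-2N-2k},\,q^{2-2N-2\alpha-2k}\end{matrix};q^2,\,q^{-2k}\right), \] where the ${}_3\phi_2$ is the terminating sum over $l=0,\dots,k-1$.
   Context: Notation: $(a;q)_n=\prod_{i=0}^{n-1}(1-aq^i)$ (with $(a;q)_0=1$); ${}_3\phi_2\!\left(\begin{smallmatrix}a_1,a_2,a_3\\ b_1,b_2\end{smallmatrix};p,z\right)=\sum_{l\ge0}\frac{(a_1;p)_l(a_2;p)_l(a_3;p)_l}{(b_1;p)_l(b_2;p)_l(p;p)_l}z^l$. $s_\lambda$ denotes the Schur function of a partition $\lambda$; $s_\lambda(1,q^2,\dots,q^{2m-2})$ is its evaluation at $m$ variables $q^{2i}$, and $s_\lambda(1,q^2,q^4,\dots)$ its principal specialisation in infinitely many variables. $M_\alpha(k,N)$ is the $k$-th moment $\frac1N\mathbb{E}[\sum_{i=1}^N X_i^k]=\frac1N\mathbb{E}[p_k(X_1,\dots,X_N)]$ of the normalised one-point function of the discrete $q$-Laguerre orthogonal polynomial ensemble with parameter $\alpha$. It is understood here as determined by linearity from the following formula (due to Morozov–Popolitov–Shakirov, taken as given) for expectations of Schur polynomials: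 for every partition $\lambda$ of size $|\lambda|=k$, \[ \mathbb{E}[s_\lambda(X_1,\dots,X_N)]=\frac{q^{k(2-2N-\alpha)}}{(1-q^2)^k}\, \frac{s_\lambda(1,q^2,\dots,q^{2N-2})\,s_\lambda(1,q^2,\dots,q^{2N+2\alpha-2})}{s_\lambda(1,q^2,q^4,\dots)}, \] together with the expansion of the power sum $p_k=\sum_{|\lambda|=k}\chi^\lambda_{(k)}s_\lambda$ in Schur functions ($\chi^\lambda_{(k)}$ the irreducible symmetric-group character evaluated at a $k$-cycle). *)

(* Defs.v *)
From HB Require Import structures.
From mathcomp Require Import all_boot all_order all_algebra.
From mathcomp Require Import all_classical all_reals all_analysis.
Set Implicit Arguments. Unset Strict Implicit. Unset Printing Implicit Defensive.
Import Order.TTheory GRing.Theory Num.Theory.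
Import numFieldNormedType.Exports.
Local Open Scope ring_scope.

(* A partition of k is encoded as a weakly decreasing function
   'I_k -> 'I_k.+1 (parts lambda_0 >= lambda_1 >= ... , padded by zeros)
   whose parts sum to k.  Each partition of k has exactly one encoding. *)
Definition part_code (k : nat) := {ffun 'I_k -> 'I_k.+1}.

Definition is_partition (k : nat) (t : part_code k) : bool :=
  [forall i : 'I_k, forall j : 'I_k, (i <= j)%N ==> (t j <= t i)%N]
  && (\sum_(i < k) (t i : nat) == k)%N.

(* Semistandard Young tableaux of shape t with entries in {1,..,m}:
   T (i,j) = 0 exactly for the cells (i,j) outside the Young diagram,
   rows weakly increase, columns strictly increase. *)
Definition is_ssyt (k m : nat) (t : part_code k)
    (T : {ffun 'I_k * 'I_k -> 'I_m.+1}) : bool :=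
  [forall c : 'I_k * 'I_k, (T c == ord0) == (t c.1 <= c.2)%N]
  && [forall i : 'I_k, forall j : 'I_k, forall j' : 'I_k,
        ((j <= j')%N && (j' < t i)%N) ==> (T (i, j) <= T (i, j'))%N]
  && [forall i : 'I_k, forall i' : 'I_k, forall j : 'I_k,
        ((i < i')%N && (j < t i')%N) ==> (T (i, j) < T (i', j))%N].

Definition schur (R : comNzRingType) (k m : nat) (x : nat -> R)
    (t : part_code k) : R :=
  \sum_(T : {ffun 'I_k * 'I_k -> 'I_m.+1} | is_ssyt t T)
     \prod_(c : 'I_k * 'I_k | (c.2 < t c.1)%N) x (T c).-1.

Definition psum (R : comNzRingType) (m k : nat) (x : nat -> R) : R :=
  \sum_(i < m) x i ^+ k.

Definition schur_geom (R : comNzRingType) (k m : nat) (q : R) (t : part_code k) : R :=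
  schur m (fun i => q ^+ (2 * i)) t.

Definition schur_inf (R : realType) (k : nat) (q : R) (t : part_code k) : R :=
  limn ((fun m => schur_geom m q t) : nat -> R).

(* Morozov--Popolitov--Shakirov formula for E[s_t(X_1..X_N)], |t| = k. *)
Definition E_schur (R : realType) (q : R) (alpha N k : nat) (t : part_code k) : R :=
  q ^ (k%:Z * (2 - 2 * N%:Z - alpha%:Z)) / (1 - q ^+ 2) ^+ k
  * schur_geom N q t * schur_geom (N + alpha) q t / schur_inf q t.

Definition is_schur_expansion (R : comNzRingType) (k N : nat)
    (c : part_code k -> R) : Prop :=
  forall x : nat -> R,
    psum N k x = \sum_(t : part_code k | is_partition t) c t * schur N x t.

(* M_alpha(k,N) = (1/N) E[p_k], computed by linearity from a Schur
   expansion c of p_k (c_lambda = chi^lambda_(k)). *)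
Definition moment (R : realType) (q : R) (alpha k N : nat)
    (c : part_code k -> R) : R :=
  N%:R^-1 * \sum_(t : part_code k | is_partition t) c t * E_schur q alpha N t.

Definition qpoch (R : ringType) (a p : R) (n : nat) : R :=
  \prod_(i < n) (1 - a * p ^+ i).

Definition phi32_trunc (R : fieldType) (n : nat) (a1 a2 a3 b1 b2 p z : R) : R :=
  \sum_(l < n)
    (qpoch a1 p l * qpoch a2 p l * qpoch a3 p l)
    / (qpoch b1 p l * qpoch b2 p l * qpoch p p l) * z ^+ l.

(* Main.v *)
(* Among the Schur functions of size k only the hooks (k-r,1^r) occur in p_k, with
   coefficient (-1)^r.  At the geometric point each hook is given by the hook-content
   formula, so E[p_k] is an alternating sum of k explicit products, and its r-th term
   is the r-th term of the 3phi2 after reversing the q-shifted factorials.  An arbitrary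
   expansion of p_k in N variables yields the same value because the nonzero Schur
   polynomials in N variables are linearly independent (Kronecker substitution: their
   leading exponents are pairwise distinct), while the others contribute E[s_t] = 0. *)

Require Import Defs.
From HB Require Import structures.
From mathcomp Require Import all_boot all_order all_algebra.
From mathcomp Require Import all_classical all_reals all_analysis.
From mathcomp Require Import ring zify.
Set Implicit Arguments. Unset Strict Implicit. Unset Printing Implicit Defensive.
Import Order.TTheory GRing.Theory Num.Theory.
Import numFieldNormedType.Exports.
Local Open Scope ring_scope.

(** * Alternating sums of complete and elementary chains *)

(* Complete homogeneous polynomial of degree n in x_a, ..., x_(m-1), summed from the
   smallest index up; [schain] is the elementary one in x_(a+1), ..., x_(m-1). *)
Fixpoint wchain (R : comNzRingType) (x : nat -> R) (m n a : nat) : R :=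
  if n is n'.+1 then \sum_(a <= b < m) x b * wchain x m n' b else 1.
Arguments wchain {R} x m n a : simpl never.

Fixpoint schain (R : comNzRingType) (x : nat -> R) (m n a : nat) : R :=
  if n is n'.+1 then \sum_(a.+1 <= b < m) x b * schain x m n' b else 1.
Arguments schain {R} x m n a : simpl never.

Lemma wchainS (R : comNzRingType) (x : nat -> R) (m n a : nat) :
  wchain x m n.+1 a = \sum_(a <= b < m) x b * wchain x m n b.
Proof. by []. Qed.

Lemma schainS (R : comNzRingType) (x : nat -> R) (m n a : nat) :
  schain x m n.+1 a = \sum_(a.+1 <= b < m) x b * schain x m n b.
Proof. by []. Qed.

Lemma wchain_recl (R : comNzRingType) (x : nat -> R) (m n a : nat) : (a < m)%N ->
  wchain x m n.+1 a = x a * wchain x m n a + wchain x m n.+1 a.+1.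
Proof. by move=> lt_am; rewrite wchainS big_ltn. Qed.

Lemma schain_recl (R : comNzRingType) (x : nat -> R) (m n a : nat) : (a.+1 < m)%N ->
  schain x m n.+1 a = x a.+1 * schain x m n a.+1 + schain x m n.+1 a.+1.
Proof. by move=> lt_am; rewrite schainS big_ltn. Qed.

(** The recursion of [wchain] at its smallest index, applied termwise; in the last term, [r = n.+1],
    the complete factor is [1] from either start. *)
Lemma alt_chain_split (R : comNzRingType) (x : nat -> R) (m n a : nat) : (a < m)%N ->
  \sum_(r < n.+2) (-1) ^+ r * (wchain x m (n.+1 - r) a * schain x m r a) =
  \sum_(r < n.+2) (-1) ^+ r * (wchain x m (n.+1 - r) a.+1 * schain x m r a)
  + x a * \sum_(r < n.+1) (-1) ^+ r * (wchain x m (n - r) a * schain x m r a).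
Proof.
move=> lt_am; rewrite big_ord_recr [in RHS]big_ord_recr /= !subnn.
rewrite [RHS]addrAC; congr (_ + _).
rewrite mulr_sumr -big_split /=; apply: eq_bigr => r _.
rewrite subSn ?leq_ord // wchain_recl //; ring.
Qed.

(** Both chains run over the variables from [a.+1] on, so this is the positive-degree part of
    $H(z)E(-z)=1$; the variables are stripped off from below. *)
Lemma alt_chain_delta (R : comNzRingType) (x : nat -> R) (m n a : nat) : (a < m)%N ->
  \sum_(r < n.+2) (-1) ^+ r * (wchain x m (n.+1 - r) a.+1 * schain x m r a) = 0.
Proof.
move=> lt_am; have [d] := ubnP (m - a); elim: d => // d IHd in a lt_am *.
move=> le_d; case: (ltnP a.+1 m) => [lt_aSm | le_mSa].
  transitivity (\sum_(r < n.+2) (-1) ^+ r * (wchain x m (n.+1 - r) a.+2 * schain x m r a.+1)).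
    (* On the right this multiple of [x a.+1] is absorbed by [alt_chain_split]; on the left the
       recursion of [schain] yields it with the opposite sign, and it cancels. *)
    apply: (addIr (x a.+1 * \sum_(r < n.+1) (-1) ^+ r *
             (wchain x m (n - r) a.+1 * schain x m r a.+1))).
    rewrite -alt_chain_split // big_ord_recl [in RHS]big_ord_recl /=.
    rewrite -addrA; congr (_ + _); rewrite mulr_sumr -big_split /=.
    apply: eq_bigr => r _; rewrite /bump add1n subSS schain_recl // exprS; ring.
  by apply: IHd => //; lia.
apply: big1 => -[[|r] /= _] _; first by rewrite wchainS big_geq // mul0r mulr0.
by rewrite schainS big_geq // !mulr0.
Qed.

(* The generating-function identity
   [x_a / (1 - x_a z) = x_a * \prod_(i >= a) (1 - x_i z)^-1 * \prod_(i > a) (1 - x_i z)]. *)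
Lemma alt_chain (R : comNzRingType) (x : nat -> R) (m n a : nat) : (a < m)%N ->
  \sum_(r < n.+1) (-1) ^+ r * (wchain x m (n - r) a * schain x m r a) = x a ^+ n.
Proof.
move=> lt_am; elim: n => [|n IHn]; first by rewrite big_ord1 !mulr1.
by rewrite alt_chain_split // alt_chain_delta // add0r IHn exprS.
Qed.

(** * q-shifted factorials and chains at a geometric point *)

Lemma qpochSl (R : comNzRingType) (a p : R) (n : nat) :
  qpoch a p n.+1 = (1 - a) * qpoch (a * p) p n.
Proof.
rewrite /qpoch big_ord_recl expr0 mulr1; congr (_ * _).
by apply: eq_bigr => i _; rewrite /= /bump add1n exprS mulrA.
Qed.

Lemma qpochSr (R : comNzRingType) (a p : R) (n : nat) :
  qpoch a p n.+1 = qpoch a p n * (1 - a * p ^+ n).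
Proof. by rewrite /qpoch big_ord_recr. Qed.

Lemma qpochD (R : comNzRingType) (a p : R) (m n : nat) :
  qpoch a p (m + n) = qpoch a p m * qpoch (a * p ^+ m) p n.
Proof.
rewrite /qpoch big_split_ord; congr (_ * _).
by apply: eq_bigr => i _; rewrite /= exprD mulrA.
Qed.

Lemma qpoch_neq0 (R : realFieldType) (Q : R) (n : nat) :
  0 < Q -> Q < 1 -> qpoch Q Q n != 0.
Proof.
move=> Q0 Q1; apply/prodf_neq0 => i _.
by rewrite -exprS subr_eq0 eq_sym lt_eqF // exprn_ilt1 // ltW.
Qed.

(** The quotient is the Gaussian binomial $\binom{p+n-1}{n}_Q$ for [p] variables; the double
    induction is the q-Pascal rule. *)
Lemma wchain_geom (R : realFieldType) (Q : R) (n p a : nat) : 0 < Q -> Q < 1 ->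
  wchain (fun i => Q ^+ i) (a + p) n a = Q ^+ (a * n) * qpoch (Q ^+ p) Q n / qpoch Q Q n.
Proof.
move=> Q0 Q1; elim: n p a => [|n IHn] p a.
  by rewrite muln0 /qpoch !big_ord0 divr1 mulr1.
elim: p a => [|p IHp] a.
  by rewrite addn0 qpochSl expr0 subrr !mul0r mulr0 mul0r wchainS big_geq.
rewrite wchain_recl; last by lia.
rewrite IHn -addSnnS IHp (qpochSr (Q ^+ p.+1)) (qpochSr Q) qpochSl -exprSr.
have nz := qpoch_neq0 n Q0 Q1; have := qpoch_neq0 n.+1 Q0 Q1.
rewrite qpochSr mulf_eq0 negb_or => /andP[_ nz1].
rewrite mulSn mulnS !exprD !exprS.
by field; rewrite nz nz1.
Qed.

(** The Gaussian binomial $\binom{p}{n}_Q$ for the [p] variables above [a]. The quotient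
    [Q ^+ p.+1 / Q ^+ n] also covers [n > p], where one factor of the shifted factorial vanishes. *)
Lemma schain_geom (R : realFieldType) (Q : R) (n p a : nat) : 0 < Q -> Q < 1 ->
  schain (fun i => Q ^+ i) (a + p.+1) n a =
  Q ^+ (a.+1 * n + 'C(n, 2)) * qpoch (Q ^+ p.+1 / Q ^+ n) Q n / qpoch Q Q n.
Proof.
move=> Q0 Q1; have Qn0 i : Q ^+ i != 0 by rewrite expf_neq0 // gt_eqF.
elim: n p a => [|n IHn] p a.
  by rewrite muln0 /qpoch !big_ord0 divr1 mulr1.
elim: p a => [|p IHp] a.
  rewrite addn1 schainS big_geq // qpochSr.
  have -> : Q ^+ 1 / Q ^+ n.+1 * Q ^+ n = 1 by rewrite (exprS _ n); field; rewrite Qn0 gt_eqF.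
  by rewrite subrr !(mulr0, mul0r).
rewrite schain_recl; last by lia.
rewrite -addSnnS IHn IHp.
have -> : Q ^+ p.+2 / Q ^+ n.+1 = Q ^+ p.+1 / Q ^+ n.
  by rewrite !(exprS _ n) (exprS _ p.+1); field; rewrite Qn0 gt_eqF.
rewrite (qpochSr (_ / Q ^+ n)) (qpochSr Q) qpochSl.
have -> : Q ^+ p.+1 / Q ^+ n.+1 * Q = Q ^+ p.+1 / Q ^+ n.
  by rewrite !(exprS _ n); field; rewrite Qn0 gt_eqF.
have nz := qpoch_neq0 n Q0 Q1; have := qpoch_neq0 n.+1 Q0 Q1.
rewrite qpochSr mulf_eq0 negb_or => /andP[_ nz1].
rewrite binS bin1 !mulSn !mulnS !exprD !exprS.
field; by rewrite nz nz1 Qn0 gt_eqF.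
Qed.

(* The hook-content formula for the hook with arm A and leg B. *)
Lemma hook_chain_geom (R : realFieldType) (Q : R) (A B m : nat) : 0 < Q -> Q < 1 ->
  \sum_(a < m) Q ^+ a * (wchain (fun i => Q ^+ i) m A a * schain (fun i => Q ^+ i) m B a) =
  Q ^+ 'C(B.+1, 2) * qpoch (Q ^+ m / Q ^+ B) Q (A + B).+1 /
  ((1 - Q ^+ (A + B).+1) * qpoch Q Q A * qpoch Q Q B).
Proof.
move=> Q0 Q1; have Qn0 i : Q ^+ i != 0 by rewrite expf_neq0 // gt_eqF.
(* Apart from [Q ^+ ((A + B).+1 * a)], a summand depends only on the number of variables above [a];
   raising [m] by one thus multiplies the old sum by [Q ^+ (A + B).+1] and adds [G m]. *)
pose G p := Q ^+ 'C(B.+1, 2) * qpoch (Q ^+ p.+1) Q A * qpoch (Q ^+ p.+1 / Q ^+ B) Q B /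
  (qpoch Q Q A * qpoch Q Q B).
transitivity (\sum_(a < m) Q ^+ ((A + B).+1 * a) * G (m - a.+1)%N).
  apply: eq_bigr => -[a /= lt_am] _; have [p ->] : exists p, m = (a + p.+1)%N.
    by exists (m - a.+1)%N; lia.
  rewrite wchain_geom // schain_geom // (_ : a + p.+1 - a.+1 = p)%N; last by lia.
  rewrite /G binS bin1 !mulSn mulnDl (mulnC A) (mulnC B) !exprD.
  by rewrite !invfM; ring.
have nzk : 1 - Q ^+ (A + B).+1 != 0.
  by rewrite subr_eq0 eq_sym lt_eqF // exprn_ilt1 // ltW.
elim: m => [|m IHm].
  rewrite big_ord0 (addnC A) -addnS qpochD qpochSl divfK //.
  by rewrite subrr !(mul0r, mulr0).
rewrite big_ord_recl muln0 expr0 mul1r subn1 /=.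
under eq_bigr => i _ do rewrite /bump add1n mulnS exprD -mulrA subSS.
rewrite -mulr_sumr IHm.
(* The shifted factorials for [m.+1] and [m] share [A + B] factors; the former has an extra last
   factor, the latter an extra first one. *)
have -> : qpoch (Q ^+ m.+1 / Q ^+ B) Q (A + B).+1 =
   qpoch (Q ^+ m.+1 / Q ^+ B) Q B * qpoch (Q ^+ m.+1) Q A * (1 - Q ^+ m.+1 * Q ^+ A).
  rewrite qpochSr (addnC A) qpochD divfK //; congr (_ * (1 - _)).
  by rewrite exprD mulrA divfK.
have -> : qpoch (Q ^+ m / Q ^+ B) Q (A + B).+1 =
   (1 - Q ^+ m / Q ^+ B) * (qpoch (Q ^+ m.+1 / Q ^+ B) Q B * qpoch (Q ^+ m.+1) Q A).
  rewrite qpochSl; congr (_ * _).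
  rewrite (_ : _ / _ * Q = Q ^+ m.+1 / Q ^+ B); last by rewrite exprSr mulrAC.
  by rewrite (addnC A) qpochD divfK.
have nzA := qpoch_neq0 A Q0 Q1; have nzB := qpoch_neq0 B Q0 Q1.
rewrite /G; move: nzk; rewrite !exprS !exprD => nzk.
by field; rewrite nzA nzB nzk Qn0.
Qed.

(** * Hook shapes and their tableaux *)

Definition hook (k r : nat) : part_code k :=
  [ffun i : 'I_k => inord (if (i : nat) == 0%N then k - r else (i <= r))%N].

Lemma hookE (k r : nat) (i : 'I_k) :
  hook k r i = (if (i : nat) == 0%N then k - r else (i <= r))%N :> nat.
Proof.
rewrite ffunE inordK //; case: ifP => _; first by lia.
by have := ltn_ord i; case: (i <= r)%N => /=; lia.
Qed.

Lemma is_partition_hook (k r : nat) : (r < k)%N -> is_partition (hook k r).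
Proof.
move=> lt_rk; apply/andP; split.
  apply/forallP => i; apply/forallP => j; apply/implyP => le_ij.
  rewrite !hookE; case: eqP => [j0|_]; first by rewrite (_ : (i : nat) == 0)%N //; lia.
  by case: eqP => _; lia.
case: k lt_rk => // k lt_rk.
rewrite big_ord_recl hookE /=.
have sumE n : (\sum_(i < n) (i < r) = minn n r)%N.
  by elim: n => [|n IHn]; rewrite ?big_ord0 ?big_ord_recr /= ?IHn; lia.
by under eq_bigr => i _ do rewrite hookE /= /bump add1n; rewrite sumE; lia.
Qed.

Lemma big_tuple_cons (R : Type) (idx : R) (op : Monoid.com_law idx) (T : finType)
    (n : nat) (P : pred (n.+1.-tuple T)) (F : n.+1.-tuple T -> R) :
  \big[op/idx]_(s | P s) F s =
  \big[op/idx]_b \big[op/idx]_(s : n.-tuple T | P (cons_tuple b s)) F (cons_tuple b s).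
Proof.
rewrite pair_big_dep /=.
rewrite (reindex (fun p : T * n.-tuple T => cons_tuple p.1 p.2)) //=.
exists (fun s => (thead s, [tuple of behead s])) => [[b s] _ | s _].
  by congr pair => //; apply: val_inj.
by rewrite /= [s in RHS]tuple_eta; apply: val_inj.
Qed.

(** Weakly increasing paths from a corner [a] are the arms of hook tableaux, as the strict paths of
    the next lemma are the legs; peeling off the head gives the recursion of [wchain]. *)
Lemma sum_tuple_path_leq (R : comNzRingType) (x : nat -> R) (m n a : nat) :
  \sum_(s : n.-tuple 'I_m | path leq a (map val s)) \prod_(i <- s) x i = wchain x m n a.
Proof.
elim: n a => [|n IHn] a.
  rewrite (big_pred1 [tuple]) => [|s]; first by rewrite big_nil.
  by rewrite tuple0 /= eqxx.
rewrite big_tuple_cons wchainS big_geq_mkord big_mkcond /= [RHS]big_mkcond /=.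
apply: eq_bigr => b _; case: leqP => le_ab; last by rewrite big_pred0.
rewrite -IHn mulr_sumr; apply: eq_bigr => s _; exact: big_cons.
Qed.

Lemma sum_tuple_path_ltn (R : comNzRingType) (x : nat -> R) (m n a : nat) :
  \sum_(s : n.-tuple 'I_m | path ltn a (map val s)) \prod_(i <- s) x i = schain x m n a.
Proof.
elim: n a => [|n IHn] a.
  rewrite (big_pred1 [tuple]) => [|s]; first by rewrite big_nil.
  by rewrite tuple0 /= eqxx.
rewrite big_tuple_cons schainS big_geq_mkord big_mkcond /= [RHS]big_mkcond /=.
apply: eq_bigr => b _; case: (ltnP a b) => le_ab; last by rewrite big_pred0.
rewrite -IHn mulr_sumr; apply: eq_bigr => s _; exact: big_cons.
Qed.

(* The filling of a hook read off its first row [l1] and first column [l2],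
   which share the corner entry. *)
Definition hook_entry (l1 l2 : seq nat) (i j : nat) : nat :=
  nth 0%N (if i == 0%N then l1 else if j == 0%N then l2 else [::]) (i + j).

(** With positive entries, the default [0] of [nth] appears exactly past the end, matching the rule
    of [is_ssyt] that [0] marks the cells outside the diagram. *)
Lemma nth_eq0 (l : seq nat) (n : nat) : 0%N \notin l ->
  (nth 0%N l n == 0%N) = (size l <= n)%N.
Proof.
move=> l0; case: leqP => [/(nth_default _)-> // | lt_n].
by apply: contraNF l0 => /eqP <-; rewrite mem_nth.
Qed.

(** Only row 0 and column 0 of a hook can hold two cells to compare. *)
Lemma is_ssyt_hook (k r m : nat) (l1 l2 : seq nat)
    (T : {ffun 'I_k.+1 * 'I_k.+1 -> 'I_m.+1}) :
  (r <= k)%N -> size l1 = (k - r).+1 -> size l2 = r.+1 -> 0%N \notin l1 -> 0%N \notin l2 ->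
  nth 0%N l1 0 = nth 0%N l2 0 ->
  (forall c, T c = hook_entry l1 l2 c.1 c.2 :> nat) ->
  is_ssyt (hook k.+1 r) T = sorted leq l1 && sorted ltn l2.
Proof.
move=> le_rk sz1 sz2 l10 l20 e00 TE.
have col i : hook_entry l1 l2 i 0 = nth 0%N l2 i.
  by rewrite /hook_entry addn0; case: i => //=.
apply/andP/andP => [[/andP[_ /forallP rows] /forallP cols] | [s1 s2]].
  split; rewrite sorted_pairwise; try exact: leq_trans; try exact: ltn_trans.
    apply/(pairwiseP 0%N) => i j; rewrite !inE sz1 => lt_i lt_j lt_ij.
    have lt_ik : (i < k.+1)%N by lia.
    have lt_jk : (j < k.+1)%N by lia.
    have /forallP/(_ (Ordinal lt_ik))/forallP/(_ (Ordinal lt_jk)) := rows ord0.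
    by rewrite hookE !TE /= /hook_entry !add0n ltnW //= subSn // lt_j.
  apply/(pairwiseP 0%N) => i j; rewrite !inE sz2 => lt_i lt_j lt_ij.
  have lt_ik : (i < k.+1)%N by lia.
  have lt_jk : (j < k.+1)%N by lia.
  have /forallP/(_ (Ordinal lt_jk))/forallP/(_ ord0) := cols (Ordinal lt_ik).
  rewrite hookE !TE /= !col lt_ij /=; case: eqP => [|_]; first by lia.
  by rewrite -(ltnS j r) lt_j.
split; [apply/andP; split|].
- apply/forallP => -[i j]; rewrite -val_eqE /= TE /= hookE /hook_entry.
  case: (eqVneq (i : nat) 0%N) => [->|i0]; first by rewrite add0n nth_eq0 // sz1 subSn.
  case: (eqVneq (j : nat) 0%N) => [->|j0]; first by rewrite addn0 nth_eq0 // sz2; case: (leqP i r) => /=; lia.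
  by rewrite nth_nil eqxx; case: (_ <= r)%N; lia.
- apply/forallP => i; apply/forallP => j; apply/forallP => j'; apply/implyP => /andP[le_j].
  rewrite hookE !TE /= /hook_entry; case: eqP => [i0|_] lt_j'.
    by rewrite i0 !add0n; apply: (sorted_leq_nth leq_trans leqnn) => //; rewrite ?inE ?sz1; lia.
  by have -> : j = j' by apply: val_inj => /=; move: lt_j'; case: (_ <= r)%N; lia.
- apply/forallP => i; apply/forallP => i'; apply/forallP => j; apply/implyP => /andP[lt_i].
  rewrite hookE !TE /=; case: eqP => [|_]; first by lia.
  case: leqP => // le_i' lt_j; have -> : (j : nat) = 0%N by lia.
  by rewrite !col; apply: (sorted_ltn_nth ltn_trans) => //; rewrite ?inE ?sz2; lia.
Qed.

(** Row 0 gives the corner and the arm, each later row of the hook its single cell. The shift by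
    [succn] undoes the predecessor in [schur]. *)
Lemma prod_hook (R : comNzRingType) (x : nat -> R) (k r m a : nat) (s u : seq nat)
    (T : {ffun 'I_k.+1 * 'I_k.+1 -> 'I_m.+1}) :
  (r <= k)%N -> size s = (k - r)%N -> size u = r ->
  (forall c, T c = hook_entry (map succn (a :: s)) (map succn (a :: u)) c.1 c.2 :> nat) ->
  \prod_(c : 'I_k.+1 * 'I_k.+1 | (c.2 < hook k.+1 r c.1)%N) x (T c).-1 =
  x a * (\prod_(i <- s) x i * \prod_(i <- u) x i).
Proof.
move=> le_rk szs szu TE.
have widen n l (F : nat -> R) : (n <= l)%N ->
    \prod_(j < l | (j < n)%N) F j = \prod_(j < n) F j.
  by move=> le_nl; rewrite (big_ord_widen l).
have prodE (l : seq nat) : \prod_(i <- l) x i = \prod_(j < size l) x (nth 0%N l j).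
  by rewrite (big_nth 0%N) big_mkord.
rewrite (eq_bigr (fun c : 'I_k.+1 * 'I_k.+1 => x (hook_entry (map succn (a :: s)) (map succn (a :: u)) c.1 c.2).-1));
  last by move=> c _; rewrite TE.
rewrite -(pair_big_dep xpredT (fun i j : 'I_k.+1 => (j < hook k.+1 r i)%N)
  (fun i j : 'I_k.+1 => x (hook_entry (map succn (a :: s)) (map succn (a :: u)) i j).-1)) /=.
rewrite big_ord_recl mulrA; congr (_ * _).
  under eq_bigl => j do rewrite hookE /=.
  rewrite (widen _ _ (fun j => x (hook_entry (map succn (a :: s)) (map succn (a :: u)) 0 j).-1)); last by lia.
  transitivity (\prod_(i <- a :: s) x i); last by rewrite big_cons.
  rewrite prodE /= szs subSn //; apply: eq_bigr => j _.
  rewrite /hook_entry add0n eqxx -map_cons (nth_map 0%N) //= szs; exact: ltn_ord.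
transitivity (\prod_(i < k | (i < r)%N) x (nth 0%N u i)).
  rewrite [RHS]big_mkcond; apply: eq_bigr => i _.
  under eq_bigl => j do rewrite hookE /= /bump add1n.
  case: (ltnP i r) => lt_i; last by rewrite big_pred0 // => j; lia.
  rewrite (widen 1%N _ (fun j => x (hook_entry (map succn (a :: s)) (map succn (a :: u)) (bump 0 i) j).-1)) //.
  by rewrite big_ord1 /hook_entry /bump add1n addn0 /= (nth_map 0%N) // szu.
by rewrite (widen r k (fun i => x (nth 0%N u i))) // prodE szu.
Qed.

Lemma schur_hook (R : comNzRingType) (x : nat -> R) (k r m : nat) : (r <= k)%N ->
  schur m x (hook k.+1 r) = \sum_(a < m) x a * (wchain x m (k - r) a * schain x m r a).
Proof.
move=> le_rk; case: m => [|m].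
  rewrite big_ord0 /schur big_pred0 // => T; apply/negbTE/negP => /andP[/andP[/forallP cells _] _].
  by have := cells (ord0, ord0); rewrite hookE (ord1 (T _)) eqxx /=; lia.
(* Triples of corner, arm and leg: [h] fills the hook with them and [h'] reads them off. *)
pose S3 := ('I_m.+1 * ((k - r).-tuple 'I_m.+1 * r.-tuple 'I_m.+1))%type.
pose sq n (a : 'I_m.+1) (s : n.-tuple 'I_m.+1) := [seq i.+1 | i <- [seq val i | i <- a :: s]].
pose h (p : S3) : {ffun 'I_k.+1 * 'I_k.+1 -> 'I_m.+2} :=
  [ffun c : 'I_k.+1 * 'I_k.+1 => inord (hook_entry (sq _ p.1 p.2.1) (sq _ p.1 p.2.2) c.1 c.2)].
pose h' (T : {ffun 'I_k.+1 * 'I_k.+1 -> 'I_m.+2}) : S3 :=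
  (inord (T (ord0, ord0)).-1,
   ([tuple inord (T (ord0, inord i.+1)).-1 | i < k - r],
    [tuple inord (T (inord i.+1, ord0)).-1 | i < r])).
have sq0 n a (s : n.-tuple 'I_m.+1) : 0%N \notin sq n a s by apply/mapP => -[].
have sq_size n a (s : n.-tuple 'I_m.+1) : size (sq n a s) = n.+1.
  by rewrite !size_map /= size_tuple.
have sq_lt n a (s : n.-tuple 'I_m.+1) i : (nth 0%N (sq n a s) i < m.+2)%N.
  case: (ltnP i (size (sq n a s))) => [lt_i|ge_i]; last by rewrite nth_default.
  by have /mapP[_ /mapP[j _ ->] ->] := mem_nth 0%N lt_i; rewrite ltnS ltn_ord.
have hE p (c : 'I_k.+1 * 'I_k.+1) : h p c = hook_entry (sq _ p.1 p.2.1) (sq _ p.1 p.2.2) c.1 c.2 :> nat.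
  rewrite ffunE inordK // /hook_entry; case: ifP => _ //; case: ifP => _ //.
  by rewrite nth_nil.
have hK p : h' (h p) = p.
  case: p => a [s u]; congr (_, (_, _)).
  - by apply: val_inj; rewrite hE /= inordK.
  - apply: eq_from_tnth => i; rewrite tnth_mktuple; apply: val_inj.
    have lt_i : (i.+1 < k.+1)%N by have := ltn_ord i; lia.
    rewrite hE /= (inordK lt_i).
    rewrite /hook_entry add0n /= (nth_map 0%N); last by rewrite size_map size_tuple.
    by rewrite (nth_map ord0) ?size_tuple //= -tnth_nth inordK.
  - apply: eq_from_tnth => i; rewrite tnth_mktuple; apply: val_inj.
    have lt_i : (i.+1 < k.+1)%N by have := ltn_ord i; lia.
    rewrite hE /= (inordK lt_i).
    rewrite /hook_entry addn0 /= (nth_map 0%N); last by rewrite size_map size_tuple.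
    by rewrite (nth_map ord0) ?size_tuple //= -tnth_nth inordK.
have hS p : is_ssyt (hook k.+1 r) (h p) =
    path leq p.1 (map val p.2.1) && path ltn p.1 (map val p.2.2).
  rewrite (is_ssyt_hook le_rk (sq_size _ _ _) (sq_size _ _ _) (sq0 _ _ _) (sq0 _ _ _) _ (hE p)) //.
  by rewrite /sq !sorted_map /= !path_map.
(* [h (h' T) = T] uses that a tableau is nonzero on the hook, so that predecessor and successor
   cancel, and zero off it. *)
rewrite /schur (reindex_onto h h') => [|T]; last first.
  case/andP=> /andP[/forallP cells _] _; apply/ffunP => -[i j]; apply: val_inj.
  have predK (c : 'I_k.+1 * 'I_k.+1) : (c.2 < hook k.+1 r c.1)%N -> (inord (T c).-1 : 'I_m.+1).+1 = T c.
    move=> Hc; have := cells c; rewrite leqNgt Hc -val_eqE /= => /eqP/negbT Tc0.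
    by rewrite inordK prednK ?lt0n // -ltnS; exact: ltn_ord.
  have T0 (c : 'I_k.+1 * 'I_k.+1) : (hook k.+1 r c.1 <= c.2)%N -> T c = 0%N :> nat.
    by move=> Hc; have := cells c; rewrite Hc => /eqP/eqP->.
  have nthE n (F : 'I_n -> 'I_m.+1) l :
      nth 0%N [seq i.+1 | i <- [seq val i | i <- [tuple F i | i < n]]] l =
      if insub l is Some i' then (F i').+1 else 0%N.
    case: insubP => [i' lt_l <-|]; last first.
      by rewrite -leqNgt => le_l; rewrite nth_default // size_map size_map size_tuple.
    rewrite (nth_map 0%N); last by rewrite size_map size_tuple; exact: ltn_ord.
    rewrite (nth_map ord0); last by rewrite size_tuple; exact: ltn_ord.
    by rewrite nth_mktuple.
  rewrite [LHS]hE /= /hook_entry; case: i j => [[|i] lt_i] [[|j] lt_j] /=.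
  - have -> : Ordinal lt_i = ord0 by apply: val_inj.
    have -> : Ordinal lt_j = ord0 by apply: val_inj.
    by rewrite predK // hookE /=; lia.
  - have -> : Ordinal lt_i = ord0 by apply: val_inj.
    rewrite nthE; case: insubP => [l lt_l El|ge_l]; last by rewrite T0 // hookE /=; lia.
    have -> : inord l.+1 = Ordinal lt_j by apply: val_inj; rewrite /= El inordK.
    by rewrite predK // hookE /=; lia.
  - have -> : Ordinal lt_j = ord0 by apply: val_inj.
    rewrite addn0 nthE; case: insubP => [l lt_l El|ge_l]; last by rewrite T0 // hookE /=; lia.
    have -> : inord l.+1 = Ordinal lt_i by apply: val_inj; rewrite /= El inordK.
    by rewrite predK // hookE /=; lia.
  - by rewrite T0 // hookE /=; lia.
under eq_bigl => p do rewrite hS hK eqxx andbT.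
transitivity (\sum_(p : S3 | path leq p.1 (map val p.2.1) && path ltn p.1 (map val p.2.2))
   x p.1 * (\prod_(i <- p.2.1) x i * \prod_(i <- p.2.2) x i)).
  apply: eq_bigr => p _.
  rewrite (@prod_hook _ x k r _ p.1 (map val p.2.1) (map val p.2.2)) ?size_map ?size_tuple //.
  by rewrite !big_map.
rewrite -(pair_big_dep xpredT
  (fun (a : 'I_m.+1) (p : (k - r).-tuple 'I_m.+1 * r.-tuple 'I_m.+1) =>
     path leq a (map val p.1) && path ltn a (map val p.2))
  (fun (a : 'I_m.+1) p => x a * (\prod_(i <- p.1) x i * \prod_(i <- p.2) x i))) /=.
apply: eq_bigr => a _; rewrite -mulr_sumr; congr (_ * _).
by rewrite -sum_tuple_path_leq -sum_tuple_path_ltn big_distrlr /= pair_big.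
Qed.

(** * Linear independence of Schur polynomials *)

Lemma rmorph_schur (R S : comNzRingType) (f : {rmorphism R -> S}) (k m : nat)
    (x : nat -> R) (t : part_code k) :
  f (schur m x t) = schur m (fun i => f (x i)) t.
Proof.
by rewrite /schur rmorph_sum; apply: eq_bigr => T _; rewrite rmorph_prod.
Qed.

(** Entries are at least 1 in row 0 and grow strictly down the column; the partition condition keeps
    the cells above [(i, j)] in the diagram. *)
Lemma ssyt_gt_row (k m : nat) (t : part_code k) (T : {ffun 'I_k * 'I_k -> 'I_m.+1})
    (i j : 'I_k) :
  is_partition t -> is_ssyt t T -> (j < t i)%N -> (i < T (i, j))%N.
Proof.
move=> /andP[/forallP mono _] /andP[/andP[/forallP cells _] /forallP cols].
case: i => i; elim: i => [|i IHi] lt_ik lt_j.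
  have := cells (Ordinal lt_ik, j); rewrite /= leqNgt lt_j -val_eqE /=.
  by move=> /eqP/negbT; rewrite lt0n.
have lt_ik' := ltnW lt_ik; have lt_j' : (j < t (Ordinal lt_ik'))%N.
  apply: leq_trans lt_j _.
  by have /forallP/(_ (Ordinal lt_ik))/implyP := mono (Ordinal lt_ik'); apply => /=.
have /forallP/(_ (Ordinal lt_ik))/forallP/(_ j)/implyP := cols (Ordinal lt_ik').
rewrite /= ltnSn lt_j => /(_ isT); exact: leq_ltn_trans (IHi _ lt_j').
Qed.

(** The first column would need an entry larger than [i >= m], so there is no tableau. *)
Lemma schur_long (R : comNzRingType) (k m : nat) (x : nat -> R) (t : part_code k)
    (i : 'I_k) :
  is_partition t -> (m <= i)%N -> (0 < t i)%N -> schur m x t = 0.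
Proof.
move=> tP le_mi ti0; rewrite /schur big_pred0 // => T; apply/negbTE/negP => TP.
have k0 : (0 < k)%N by case: k i {x t tP T TP le_mi ti0} => [[]|].
have := leq_trans (@ssyt_gt_row _ _ _ _ i (Ordinal k0) tP TP ti0) (ltn_ord (T (i, Ordinal k0))).
by rewrite ltnNge le_mi.
Qed.

(** Every cell carries the least entry allowed by [ssyt_gt_row]; this tableau supplies the leading
    monomial. *)
Definition superstandard (k m : nat) (t : part_code k) : {ffun 'I_k * 'I_k -> 'I_m.+1} :=
  [ffun c : 'I_k * 'I_k => if (c.2 < t c.1)%N then inord c.1.+1 else ord0].

Lemma superstandard_ssyt (k m : nat) (t : part_code k) :
  is_partition t -> (forall i : 'I_k, (m <= i)%N -> t i = ord0) ->
  is_ssyt t (superstandard m t).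
Proof.
move=> /andP[/forallP mono _] short.
have row (i : 'I_k) n : (n < t i)%N -> (i.+1 < m.+1)%N.
  by move=> lt_n; rewrite ltnS ltnNge; apply/negP => /short E; rewrite E in lt_n.
apply/andP; split; [apply/andP; split|].
- apply/forallP => -[i j]; rewrite -val_eqE /= ffunE /=.
  by case: ltnP => // lt_j; rewrite inordK // (row _ _ lt_j).
- apply/forallP => i; apply/forallP => j; apply/forallP => j'; apply/implyP => /andP[le_j lt_j'].
  by rewrite !ffunE /= lt_j' (leq_ltn_trans le_j lt_j').
- apply/forallP => i; apply/forallP => i'; apply/forallP => j; apply/implyP => /andP[lt_i lt_j].
  have lt_j' : (j < t i)%N.
    apply: leq_trans lt_j _.
    by have /forallP/(_ i')/implyP := mono i; apply; exact: ltnW.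
  by rewrite !ffunE /= lt_j lt_j' !inordK ?(row _ _ lt_j) ?(row _ _ lt_j').
Qed.

(* Kronecker substitution: the exponent of the monomial of a tableau after
   [x_i := X ^ (B ^ (m - 1 - i))]; the entry [T c] stands for the variable [x_(T c - 1)]. *)
Definition kweight (k m B : nat) (t : part_code k) (T : {ffun 'I_k * 'I_k -> 'I_m.+1}) : nat :=
  (\sum_(c : 'I_k * 'I_k | (c.2 < t c.1)%N) B ^ (m - T c))%N.

(** For at most [m] rows and parts below [B], the base-[B] numeral whose digits are the parts of
    [t]. *)
Definition row_weight (k m B : nat) (t : part_code k) : nat :=
  (\sum_(c : 'I_k * 'I_k | (c.2 < t c.1)%N) B ^ (m - c.1.+1))%N.

Lemma kweight_le (k m B : nat) (t : part_code k) (T : {ffun 'I_k * 'I_k -> 'I_m.+1}) :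
  (0 < B)%N -> is_partition t -> is_ssyt t T -> (kweight B t T <= row_weight m B t)%N.
Proof.
move=> B0 tP TP; apply: leq_sum => -[i j] /= lt_j; rewrite leq_pexp2l //.
by rewrite leq_sub2l // (ssyt_gt_row tP TP).
Qed.

(** Each cell weighs at most as much as in the superstandard tableau, so equal sums force equality
    in every cell; [B > 1] then recovers the entries. *)
Lemma kweight_eq (k m B : nat) (t : part_code k) (T : {ffun 'I_k * 'I_k -> 'I_m.+1}) :
  (k < B)%N -> is_partition t -> is_ssyt t T ->
  kweight B t T = row_weight m B t -> T = superstandard m t.
Proof.
move=> lt_kB tP TP E; apply/ffunP => -[i j]; rewrite ffunE /=.
have B1 : (1 < B)%N := leq_ltn_trans (leq_ltn_trans (leq0n i) (ltn_ord i)) lt_kB.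
case: (ltnP j (t i)) => lt_j; last first.
  by case/andP: TP => /andP[/forallP/(_ (i, j)) /=]; rewrite lt_j => /eqP/eqP.
have : [forall (c : 'I_k * 'I_k | (c.2 < t c.1)%N), B ^ (m - T c) == B ^ (m - c.1.+1)]%N.
  have le (c : 'I_k * 'I_k) : (c.2 < t c.1)%N -> (B ^ (m - T c) <= B ^ (m - c.1.+1) ?= iff
      (B ^ (m - T c) == B ^ (m - c.1.+1)))%N.
    case: c => a b /= lt_b; apply/leqifP; case: eqVneq => // ne.
    rewrite ltn_neqAle ne leq_pexp2l ?leq_sub2l // ?(ssyt_gt_row tP TP) //; exact: ltnW.
  by rewrite -(leqif_sum le).2; apply/eqP.
move=> /forall_inP/(_ (i, j) lt_j); rewrite eqn_exp2l //= => /eqP E1.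
have lt_iT := ssyt_gt_row tP TP lt_j; have lt_Tm := ltn_ord (T (i, j)).
apply: val_inj; rewrite /= inordK; last exact: leq_trans lt_Tm.
by move: (nat_of_ord (T _)) E1 lt_iT lt_Tm => v; lia.
Qed.

Lemma kweight_superstandard (k m B : nat) (t : part_code k) :
  (forall i : 'I_k, (m <= i)%N -> t i = ord0) ->
  kweight B t (superstandard m t) = row_weight m B t.
Proof.
move=> short; apply: eq_bigr => -[i j] /= lt_j; rewrite ffunE /= lt_j inordK //.
by rewrite ltnS ltnNge; apply/negP => /short E; rewrite E in lt_j.
Qed.

Lemma base_expansion_inj (n B : nat) (a b : nat -> nat) :
  (forall i, a i < B)%N -> (forall i, b i < B)%N ->
  (\sum_(i < n) a i * B ^ (n - i.+1) = \sum_(i < n) b i * B ^ (n - i.+1))%N ->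
  forall i, (i < n)%N -> a i = b i.
Proof.
move=> aB bB; elim: n => // n IHn; have B0 : (0 < B)%N by apply: leq_ltn_trans (aB 0%N).
rewrite !big_ord_recr /= subnn !muln1.
have shift c : (\sum_(i < n) c i * B ^ (n.+1 - i.+1) =
    (\sum_(i < n) c i * B ^ (n - i.+1)) * B)%N.
  rewrite big_distrl /=; apply: eq_bigr => i _; rewrite -mulnA -expnSr; congr (_ * _ ^ _)%N.
  by have := ltn_ord i; lia.
rewrite !shift => E.
have En : a n = b n.
  by have := congr1 (modn^~ B) E; rewrite !modnMDl !modn_small.
have /IHn H : (\sum_(i < n) a i * B ^ (n - i.+1) = \sum_(i < n) b i * B ^ (n - i.+1))%N.
  by have := congr1 (divn^~ B) E; rewrite !divnMDl // !divn_small // !addn0.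
by move=> i; rewrite ltnS leq_eqVlt => /orP[/eqP-> // | /H].
Qed.

Lemma row_weight_inj (k m : nat) (t t' : part_code k) :
  (forall i : 'I_k, (m <= i)%N -> t i = ord0) ->
  (forall i : 'I_k, (m <= i)%N -> t' i = ord0) ->
  row_weight m k.+1 t = row_weight m k.+1 t' -> t = t'.
Proof.
pose part (u : part_code k) i := if insub i is Some j then u j : nat else 0%N.
have partB u i : (part u i < k.+1)%N by rewrite /part; case: insubP.
have rwE (u : part_code k) : (forall i : 'I_k, (m <= i)%N -> u i = ord0) ->
    row_weight m k.+1 u = (\sum_(i < m) part u i * k.+1 ^ (m - i.+1))%N.
  move=> short; rewrite /row_weight.
  rewrite -(pair_big_dep xpredT (fun i j : 'I_k => (j < u i)%N)
    (fun i _ : 'I_k => k.+1 ^ (m - i.+1))%N) /=.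
  transitivity (\sum_(i < k) part u i * k.+1 ^ (m - i.+1))%N.
    apply: eq_bigr => i _; rewrite sum_nat_const; congr (_ * _)%N.
    rewrite /part valK -[RHS]card_ord.
    have le_u : (u i <= k)%N by rewrite -ltnS.
    rewrite -sum1_card -(big_ord_widen k (fun=> 1%N) le_u) sum1_card //.
  pose F i := (part u i * k.+1 ^ (m - i.+1))%N.
  (* Terms from [minn k m] on vanish, past [k] by the default value of [part] and past [m] by
     [short], so the sums up to [k] and up to [m] agree. *)
  have F0 i : (minn k m <= i)%N -> F i = 0%N.
    rewrite /F /part => le_i; case: insubP => [j lt_i Ej|] //=.
    by rewrite short // -[nat_of_ord j]/(val j) Ej; lia.
  have trunc n : (minn k m <= n)%N -> (\sum_(i < n) F i = \sum_(i < minn k m) F i)%N.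
    move=> le_n; rewrite (big_ord_widen n _ le_n) [RHS]big_mkcond /=.
    by apply: eq_bigr => i _; case: ltnP => // /F0.
  by rewrite -[LHS]/(\sum_(i < k) F i)%N -[RHS]/(\sum_(i < m) F i)%N !trunc //; lia.
move=> st st'; rewrite !rwE // => /(base_expansion_inj (partB t) (partB t')) E.
apply/ffunP => i; case: (ltnP i m) => [/E|le_mi]; last by rewrite st ?st'.
by rewrite /part valK => /val_inj.
Qed.

(** Otherwise, among the shapes with at most [m] rows and nonzero coefficient, one of maximal row
    weight would give a nonzero leading coefficient after Kronecker substitution. *)
Lemma schur_indep (R : realFieldType) (k m : nat) (d : part_code k -> R) :
  (forall x : nat -> R, \sum_(t : part_code k | is_partition t) d t * schur m x t = 0) ->
  forall t, is_partition t -> d t = 0 \/ forall x : nat -> R, schur m x t = 0.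
Proof.
move=> dS t0 t0P.
case: (boolP [exists i : 'I_k, (m <= i)%N && (0 < t0 i)%N]).
  by case/existsP => i /andP[le_mi ti0]; right => x; exact: schur_long ti0.
rewrite negb_exists => /forallP short0; left; apply/eqP; apply/negPn/negP => dt0.
pose P t := [&& is_partition t, [forall i : 'I_k, (m <= i)%N ==> (t i == ord0)] & d t != 0].
have Pt0 : P t0.
  rewrite /P t0P dt0 andbT; apply/forallP => i; apply/implyP => le_mi.
  by have := short0 i; rewrite le_mi /= lt0n negbK.
case: (@arg_maxnP _ t0 P (row_weight m k.+1) Pt0) => t /and3P[tP /forallP short dt] tmax.
have {}short (i : 'I_k) : (m <= i)%N -> t i = ord0 by move=> le_mi; have /implyP/(_ le_mi)/eqP := short i.
pose x i : {poly R} := 'X^(k.+1 ^ (m - i.+1)).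
pose p := \sum_(u : part_code k | is_partition u) d u *: schur m x u.
have p0 : p = 0.
  apply/eqP; apply/negPn/negP => pn0.
  (* At each natural number [p] evaluates to an instance of [dS], so it has more roots than its
     degree allows. *)
  have rootp : all (root p) [seq i%:R | i <- iota 0 (size p)].
    apply/allP => y _; rewrite /root -horner_evalE rmorph_sum /=.
    rewrite -[X in _ == X](dS (fun i => (x i).[y])); apply/eqP/eq_bigr => u _.
    by rewrite horner_evalE hornerZ -horner_evalE rmorph_schur.
  have := max_poly_roots pn0 rootp; rewrite size_map size_iota ltnn.
  rewrite map_inj_uniq ?iota_uniq => [/(_ isT) // | i j /eqP].
  by rewrite eqr_nat => /eqP.
have coefS u : is_partition u -> (schur m x u)`_(row_weight m k.+1 t) =
   \sum_(T : {ffun 'I_k * 'I_k -> 'I_m.+1} | is_ssyt u T) (kweight k.+1 u T == row_weight m k.+1 t)%:R.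
  move=> uP; rewrite /schur coef_sum; apply: eq_bigr => T TP.
  rewrite /x -expr_sum coefXn eq_sym; congr (_ == _)%:R; apply: eq_bigr => -[i j] lt_j.
  by rewrite prednK //; exact: leq_ltn_trans (leq0n _) (ssyt_gt_row uP TP lt_j).
have /(congr1 (fun r : {poly R} => r`_(row_weight m k.+1 t))) := p0.
rewrite coef0 coef_sum (bigD1 t) //= coefZ coefS // [X in _ + X]big1 => [|u /andP[uP ne_ut]].
  (* In shape [t] only the superstandard tableau reaches the maximal weight, so the coefficient
     there is [d t]. *)
  rewrite addr0 (bigD1 (superstandard m t)) ?superstandard_ssyt //= kweight_superstandard //.
  rewrite eqxx [X in _ + X]big1 => [|T /andP[TP neT]].
    by rewrite addr0 mulr1; apply/eqP.
  by case: eqP => // /(kweight_eq (ltnSn k) tP TP) E; rewrite E ?eqxx // in neT.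
(* A competing shape [u] has row weight at most that of [t]; a tableau reaching this weight would
   force equality, hence [u = t]. *)
rewrite coefZ; case: (eqVneq (d u) 0) => [->|du]; first by rewrite mul0r.
case: (boolP [exists i : 'I_k, (m <= i)%N && (0 < u i)%N]).
  by case/existsP => i /andP[le_mi ui0]; rewrite (schur_long _ uP le_mi ui0) coef0 mulr0.
rewrite negb_exists => /forallP shortu.
have {}shortu (i : 'I_k) : (m <= i)%N -> u i = ord0.
  by move=> le_mi; apply/eqP; have := shortu i; rewrite le_mi /= lt0n negbK.
rewrite coefS // big1 ?mulr0 // => T TP.
case: eqP => // E; case/eqP: ne_ut; apply: (row_weight_inj (m := m)) => //.
apply/eqP; rewrite eqn_leq -{2}E kweight_le // andbT; apply: tmax.
by rewrite /P uP du andbT; apply/forallP => i; apply/implyP => /shortu/eqP.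
Qed.

(** * The hook expansion of the power sum *)

(** For a fixed corner [a] the alternating sum over legs is [x a ^+ k] by [alt_chain]; the corner
    gives the remaining factor. *)
Lemma psum_hooks (R : comNzRingType) (k m : nat) (x : nat -> R) :
  psum m k.+1 x = \sum_(r < k.+1) (-1) ^+ r * schur m x (hook k.+1 r).
Proof.
under [RHS]eq_bigr => r _ do rewrite (schur_hook _ _ (leq_ord r)) mulr_sumr.
rewrite exchange_big; apply: eq_bigr => a _ /=.
rewrite exprS -(@alt_chain _ x m k a) // mulr_sumr; apply: eq_bigr => r _; ring.
Qed.

(** For [k > 0] the character value at a [k]-cycle: a single term when [t] is a hook, an empty sum
    otherwise. *)
Definition hook_coef (R : comNzRingType) (k : nat) (t : part_code k) : R :=
  \sum_(r < k | t == hook k r) (-1) ^+ r.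

Lemma sum_hook_coef (R : comNzRingType) (k : nat) (F : part_code k -> R) :
  \sum_(t : part_code k | is_partition t) hook_coef R t * F t =
  \sum_(r < k) (-1) ^+ r * F (hook k r).
Proof.
under eq_bigr => t _ do rewrite /hook_coef mulr_suml.
rewrite (exchange_big_dep xpredT) //=; apply: eq_bigr => r _.
rewrite (big_pred1 (hook k r)) // => t /=; case: eqP => [->|]; last by rewrite andbF.
by rewrite is_partition_hook.
Qed.

Lemma hook_expansion (R : comNzRingType) (k N : nat) :
  is_schur_expansion N (@hook_coef R k.+1).
Proof. by move=> x; rewrite sum_hook_coef psum_hooks. Qed.

Lemma schur_expansion_unique (R : realFieldType) (k N : nat) (c d : part_code k -> R) :
  is_schur_expansion N c -> is_schur_expansion N d ->
  forall t, is_partition t -> c t = d t \/ forall x : nat -> R, schur N x t = 0.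
Proof.
move=> cP dP t tP.
have [x|/eqP|] := @schur_indep R k N (fun t => c t - d t) _ t tP.
- under eq_bigr => u _ do rewrite mulrBl.
  by rewrite sumrB -cP -dP subrr.
- by rewrite subr_eq0 => /eqP; left.
- by right.
Qed.

(** * Hooks at the finite and infinite principal specialisations *)

Lemma schur_geom_hook (R : realFieldType) (q : R) (k r m : nat) :
  0 < q -> q < 1 -> (r <= k)%N ->
  schur_geom m q (hook k.+1 r) =
  (q ^+ 2) ^+ 'C(r.+1, 2) * qpoch ((q ^+ 2) ^+ m / (q ^+ 2) ^+ r) (q ^+ 2) k.+1 /
  ((1 - (q ^+ 2) ^+ k.+1) * qpoch (q ^+ 2) (q ^+ 2) (k - r) * qpoch (q ^+ 2) (q ^+ 2) r).
Proof.
move=> q0 q1 le_rk; rewrite /schur_geom schur_hook //.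
have -> : (fun i => q ^+ (2 * i)) = (fun i => (q ^+ 2) ^+ i).
  by apply/funext => i; rewrite exprM.
under eq_bigr => i _ do rewrite exprM.
by rewrite hook_chain_geom ?subnK ?exprn_gt0 ?exprn_ilt1 // ltW.
Qed.

(** The number of variables enters only through one shifted factorial, which tends to 1 because
    [Q ^+ m] tends to 0. *)
Lemma schur_inf_hook (R : realType) (q : R) (k r : nat) :
  0 < q -> q < 1 -> (r <= k)%N ->
  schur_inf q (hook k.+1 r) =
  (q ^+ 2) ^+ 'C(r.+1, 2) /
  ((1 - (q ^+ 2) ^+ k.+1) * qpoch (q ^+ 2) (q ^+ 2) (k - r) * qpoch (q ^+ 2) (q ^+ 2) r).
Proof.
move=> q0 q1 le_rk; rewrite /schur_inf.
under eq_fun => m do rewrite schur_geom_hook // mulrAC.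
set Q := q ^+ 2.
have Qm0 : ((fun m => Q ^+ m : R) @ \oo --> (0 : R))%classic.
  by apply: cvg_expr; rewrite ger0_norm ?exprn_ge0 ?exprn_ilt1 // ltW.
have lim1 : ((fun m => qpoch (Q ^+ m / Q ^+ r) Q k.+1 : R) @ \oo --> (1 : R))%classic.
  rewrite /qpoch; elim: k.+1 => [|n IHn].
    by under eq_fun do rewrite big_ord0; exact: cvg_cst.
  under eq_fun => m do rewrite big_ord_recr -mulrA /=.
  have factor : (1 - Q ^+ m * (Q ^- r * Q ^+ n) @[m --> \oo] --> (1 - 0 : R))%classic.
    apply: cvgB; first exact: cvg_cst.
    by have := cvgMr_tmp (b := Q ^- r * Q ^+ n) Qm0; rewrite mul0r; apply.
  by have := cvgM IHn factor; rewrite subr0 mulr1; apply.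
apply: cvg_lim => //; have := cvgMl_tmp (a := Q ^+ 'C(r.+1, 2) / ((1 - Q ^+ k.+1) * qpoch Q Q (k - r) * qpoch Q Q r)) lim1.
by rewrite mulr1; apply.
Qed.

(** * Matching hook terms with the hypergeometric series *)

(** Writing $1-Q^i/X$ as $-Q^i/X$ times $1-X/Q^i$, and likewise with $XQ^k$ for $X$, leaves a factor
    $Q^k$ per index; the rest telescopes from [X] to [X / Q ^+ r]. *)
Lemma qpoch_reverse (R : fieldType) (Q X : R) (k r : nat) :
  Q != 0 -> X != 0 -> (forall i, (i < r)%N -> X * Q ^+ k != Q ^+ i.+1) ->
  qpoch X Q k * qpoch (Q / X) Q r / qpoch (Q / (X * Q ^+ k)) Q r =
  Q ^+ (k * r) * qpoch (X / Q ^+ r) Q k.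
Proof.
move=> Q0 X0; have Qn0 i : Q ^+ i != 0 by rewrite expf_neq0.
elim: r => [|r IHr] XQ.
  by rewrite muln0 /qpoch !big_ord0 !divr1 mulr1 mul1r.
have {}IHr := IHr (fun i lt_ir => XQ i (ltnW lt_ir)); have {}XQ := XQ r (ltnSn r).
have step : qpoch (X / Q ^+ r.+1) Q k * (1 - X / Q ^+ r.+1 * Q ^+ k) =
    (1 - X / Q ^+ r.+1) * qpoch (X / Q ^+ r) Q k.
  rewrite -qpochSr qpochSl; congr (_ * qpoch _ _ _).
  by rewrite exprS; field; rewrite Q0 Qn0.
have nz : Q * Q ^+ r - X * Q ^+ k != 0 by rewrite subr_eq0 eq_sym -exprS.
have nz1 : 1 - X / Q ^+ r.+1 * Q ^+ k != 0.
  rewrite (_ : _ - _ = (Q * Q ^+ r - X * Q ^+ k) / Q ^+ r.+1).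
    by rewrite mulf_neq0 // invr_neq0.
  by rewrite exprS; field; rewrite Q0 Qn0.
have -> : qpoch (X / Q ^+ r.+1) Q k =
    (1 - X / Q ^+ r.+1) * qpoch (X / Q ^+ r) Q k / (1 - X / Q ^+ r.+1 * Q ^+ k).
  by rewrite -step mulfK.
rewrite !(qpochSr _ _ r).
transitivity (qpoch X Q k * qpoch (Q / X) Q r / qpoch (Q / (X * Q ^+ k)) Q r *
    ((1 - Q / X * Q ^+ r) / (1 - Q / (X * Q ^+ k) * Q ^+ r))).
  by rewrite [in LHS]invfM; ring.
rewrite IHr; transitivity (Q ^+ (k * r) * qpoch (X / Q ^+ r) Q k *
    (Q ^+ k * (1 - X / Q ^+ r.+1) / (1 - X / Q ^+ r.+1 * Q ^+ k))); last first.
  by rewrite mulnS exprD; ring.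
congr (_ * _); move: nz1; rewrite exprS => nz1.
by field; rewrite !Qn0 X0 Q0 nz /= -opprB oppr_eq0.
Qed.

(** Each $1-Q^{i-k}$ is $-Q^{i-k}$ times $1-Q^{k-i}$, one of the top [r] factors of [qpoch Q Q k];
    the extra $Q^{k+1}$ per index makes the exponents $i+1$, with sum ['C(r.+1, 2)]. *)
Lemma qpoch_negpow (R : fieldType) (Q : R) (k r : nat) : Q != 0 -> (r <= k)%N ->
  qpoch (Q ^- k) Q r * qpoch Q Q (k - r) * Q ^+ (k.+1 * r) =
  (-1) ^+ r * Q ^+ 'C(r.+1, 2) * qpoch Q Q k.
Proof.
move=> Q0; elim: r => [|r IHr] lt_rk.
  by rewrite subn0 muln0 /qpoch big_ord0 !(mul1r, mulr1).
have {IHr} := IHr (ltnW lt_rk); rewrite -(subnSK lt_rk) (qpochSr Q) => IHr.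
have E : Q ^+ k.+1 * (1 - Q ^- k * Q ^+ r) = - Q ^+ r.+1 * (1 - Q * Q ^+ (k - r.+1)).
  have -> : k = (k - r.+1 + r.+1)%N by rewrite subnK.
  rewrite addnK; move: (k - r.+1)%N => u.
  by rewrite !exprS !exprD !exprS; field; rewrite Q0 !expf_neq0.
transitivity (Q ^+ k.+1 * (1 - Q ^- k * Q ^+ r) *
   (qpoch (Q ^- k) Q r * qpoch Q Q (k - r.+1) * Q ^+ (k.+1 * r))).
  by rewrite qpochSr mulnS exprD; ring.
rewrite E; transitivity (- Q ^+ r.+1 * ((-1) ^+ r * Q ^+ 'C(r.+1, 2) * qpoch Q Q k)).
  by rewrite -IHr; ring.
by rewrite (binS r.+1) bin1 exprD (exprS (-1)); ring.
Qed.

(* The hook term of the moment, with [X = q^(2N)] and [Y = q^(2N + 2 alpha)],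
   against the [r]-th term of the hypergeometric sum. *)
Lemma hook_term_phi32 (R : realFieldType) (Q X Y : R) (k r : nat) :
  0 < Q -> Q < 1 -> 0 < X -> X <= Q -> 0 < Y -> Y <= Q -> (r <= k)%N ->
  (-1) ^+ r * (Q ^+ 'C(r.+1, 2) * qpoch (X / Q ^+ r) Q k.+1 * qpoch (Y / Q ^+ r) Q k.+1 /
    ((1 - Q ^+ k.+1) * qpoch Q Q (k - r) * qpoch Q Q r)) =
  qpoch X Q k.+1 * qpoch Y Q k.+1 / qpoch Q Q k.+1 *
  ((qpoch (Q / Q ^+ k.+1) Q r * qpoch (Q / X) Q r * qpoch (Q / Y) Q r) /
   (qpoch (Q / (X * Q ^+ k.+1)) Q r * qpoch (Q / (Y * Q ^+ k.+1)) Q r * qpoch Q Q r)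
   * (Q ^- k.+1) ^+ r).
Proof.
move=> Q0 Q1 X0 XQ Y0 YQ le_rk; have Qn0 : Q != 0 by rewrite gt_eqF.
(* Keeps the lower parameters of the series from producing a zero denominator. *)
have small (Z : R) i : 0 < Z -> Z <= Q -> (i < r)%N -> Z * Q ^+ k.+1 != Q ^+ i.+1.
  move=> Z0 ZQ lt_ir; rewrite lt_eqF //.
  apply: (@le_lt_trans _ _ (Q ^+ k.+2)); first by rewrite (exprS Q k.+1) ler_wpM2r // exprn_ge0 // ltW.
  by rewrite ltr_iXn2l //; lia.
have XE := qpoch_reverse Qn0 (lt0r_neq0 X0) (fun i => small X i X0 XQ).
have YE := qpoch_reverse Qn0 (lt0r_neq0 Y0) (fun i => small Y i Y0 YQ).
have QE := qpoch_negpow Qn0 le_rk.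
have nz n : qpoch Q Q n != 0 by apply: qpoch_neq0.
have nzk : 1 - Q ^+ k.+1 != 0 by have := nz k.+1; rewrite qpochSr -exprS mulf_eq0 negb_or => /andP[].
have -> : Q / Q ^+ k.+1 = Q ^- k by rewrite exprS; field; rewrite Qn0 expf_neq0.
(* Each of the two reversals yields [Q ^+ (k.+1 * r)]: one cancels the power of the argument, the
   other the power from [qpoch_negpow]. *)
transitivity ((qpoch X Q k.+1 * qpoch (Q / X) Q r / qpoch (Q / (X * Q ^+ k.+1)) Q r) *
  (qpoch Y Q k.+1 * qpoch (Q / Y) Q r / qpoch (Q / (Y * Q ^+ k.+1)) Q r) *
  (qpoch (Q ^- k) Q r / (qpoch Q Q k.+1 * qpoch Q Q r) * (Q ^- k.+1) ^+ r)); last first.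
  by rewrite !invfM; ring.
rewrite XE YE (qpochSr Q Q k) -exprS exprVn -exprM.
have -> : qpoch (Q ^- k) Q r = (-1) ^+ r * Q ^+ 'C(r.+1, 2) * qpoch Q Q k /
    (qpoch Q Q (k - r) * Q ^+ (k.+1 * r)).
  by rewrite -QE -mulrA mulfK // mulf_neq0 // expf_neq0.
by field; rewrite !nz nzk expf_neq0.
Qed.

(** * Expectations of hooks and the moment *)

(** The two finite specialisations and the infinite one share a power of [q ^+ 2] and a denominator,
    so one copy of each survives. *)
Lemma E_schur_hook (R : realType) (q : R) (alpha k r N : nat) :
  0 < q -> q < 1 -> (r <= k)%N ->
  E_schur q alpha N (hook k.+1 r) =
  q ^ (k.+1%:Z * (2 - 2 * N%:Z - alpha%:Z)) / (1 - q ^+ 2) ^+ k.+1 *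
  ((q ^+ 2) ^+ 'C(r.+1, 2) * qpoch ((q ^+ 2) ^+ N / (q ^+ 2) ^+ r) (q ^+ 2) k.+1 *
     qpoch ((q ^+ 2) ^+ (N + alpha) / (q ^+ 2) ^+ r) (q ^+ 2) k.+1 /
   ((1 - (q ^+ 2) ^+ k.+1) * qpoch (q ^+ 2) (q ^+ 2) (k - r) * qpoch (q ^+ 2) (q ^+ 2) r)).
Proof.
move=> q0 q1 le_rk; have Q0 : 0 < q ^+ 2 by rewrite exprn_gt0.
have Q1 : q ^+ 2 < 1 by rewrite exprn_ilt1 // ltW.
rewrite /E_schur !schur_geom_hook // schur_inf_hook //.
set Q := q ^+ 2 in Q0 Q1 *; set P := q ^ _.
have nz n : qpoch Q Q n != 0 by apply: qpoch_neq0.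
have nzk : 1 - Q ^+ k.+1 != 0 by rewrite subr_eq0 eq_sym lt_eqF // exprn_ilt1 // ltW.
have nz1 : 1 - Q != 0 by rewrite subr_eq0 eq_sym lt_eqF.
have nzC : Q ^+ 'C(r.+1, 2) != 0 by rewrite expf_neq0 // gt_eqF.
set D := (1 - Q ^+ k.+1) * _ * _; have nzD : D != 0 by rewrite !mulf_neq0.
set C := Q ^+ _ in nzC *; set U := qpoch _ _ k.+1; set V := qpoch _ _ k.+1.
have : (1 - Q) ^+ k.+1 != 0 by rewrite expf_neq0.
by move: (_ ^+ k.+1) => W nzW; field; rewrite nzW nzD nzC.
Qed.

Lemma moment_hooks (R : realType) (q : R) (alpha k N : nat) (c : part_code k.+1 -> R) :
  is_schur_expansion N c ->
  moment q alpha N c =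
  N%:R^-1 * \sum_(r < k.+1) (-1) ^+ r * E_schur q alpha N (hook k.+1 r).
Proof.
move=> cP; rewrite /moment -sum_hook_coef; congr (_ * _); apply: eq_bigr => t tP.
(* Where [c] may differ from the hook coefficients, the factor [schur_geom N q t] of the expectation
   vanishes. *)
have [-> // | S0] := schur_expansion_unique cP (@hook_expansion R k N) tP.
by rewrite /E_schur /schur_geom S0 !(mulr0, mul0r).
Qed.

Theorem mainTheorem4 (R : realType) (q : R) (alpha k N : nat) :
  0 < q -> q < 1 -> (0 < k)%N -> (0 < N)%N ->
  (exists c : part_code k -> R, is_schur_expansion N c) /\
  (forall c : part_code k -> R, is_schur_expansion N c ->
     moment q alpha N c =
       q ^ (k%:Z * (2 - 2 * N%:Z - alpha%:Z)) / (N%:R * (1 - q ^+ 2) ^+ k)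
       * (qpoch (q ^+ (2 * N)) (q ^+ 2) k * qpoch (q ^+ (2 * N + 2 * alpha)) (q ^+ 2) k
          / qpoch (q ^+ 2) (q ^+ 2) k)
       * phi32_trunc k
           (q ^ (2 - 2 * k%:Z)) (q ^ (2 - 2 * N%:Z)) (q ^ (2 - 2 * N%:Z - 2 * alpha%:Z))
           (q ^ (2 - 2 * N%:Z - 2 * k%:Z)) (q ^ (2 - 2 * N%:Z - 2 * alpha%:Z - 2 * k%:Z))
           (q ^+ 2) (q ^ (- (2 * k%:Z)))).
Proof.
move=> q0 q1; case: k => // k _ N0; split.
  by exists (@hook_coef R k.+1); exact: hook_expansion.
move=> c cP; rewrite (moment_hooks _ _ cP) /phi32_trunc.
have Q0 : 0 < q ^+ 2 by rewrite exprn_gt0.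
have Q1 : q ^+ 2 < 1 by rewrite exprn_ilt1 // ltW.
have powz n : q ^ (2 - 2 * n%:Z) = q ^+ 2 / (q ^+ 2) ^+ n.
  by rewrite expfzDr ?gt_eqF // -exprM exprnN.
(* All parameter exponents are brought to the form [2 - 2 * n%:Z], which [powz] turns into quotients
   of powers of [q ^+ 2]. *)
have -> : 2 - 2 * N%:Z - 2 * alpha%:Z = 2 - 2 * (N + alpha)%:Z by lia.
have -> : 2 - 2 * N%:Z - 2 * k.+1%:Z = 2 - 2 * (N + k.+1)%:Z by lia.
have -> : 2 - 2 * (N + alpha)%:Z - 2 * k.+1%:Z = 2 - 2 * (N + alpha + k.+1)%:Z by lia.
rewrite !powz -mulnDr !exprM !(exprD _ _ k.+1).
have -> : q ^ (- (2 * k.+1%:Z)) = (q ^+ 2) ^- k.+1 by rewrite -exprM exprnN.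
have XQ n : (0 < n)%N -> (q ^+ 2) ^+ n <= q ^+ 2.
  by move=> n0; rewrite -[X in _ <= X]expr1 ler_wiXn2l // ltW.
rewrite !mulr_sumr; apply: eq_bigr => r _.
rewrite E_schur_hook ?leq_ord // [(-1) ^+ r * (_ * _)]mulrCA hook_term_phi32 ?leq_ord ?exprn_gt0 ?XQ //.
- by rewrite (invfM N%:R); ring.
- by rewrite addn_gt0 N0.
Qed.
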